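(* Let $\Gamma=\mathbb{Z}[i]$ and $x=a+bi$ with $a,b\in\mathbb{R}$. If $a$ or $b$ is irrational, then $\mathrm{OC}(x+\Gamma)$ is a group of at most two elements. In particular: (i) If $a$ is irrational and $b$ is rational, then $\mathrm{OC}(x+\Gamma)=\langle T_r\rangle$ if $2b\in\mathbb{Z}$, and $\mathrm{OC}(x+\Gamma)=\{\mathbf{1}\}$ otherwise. (ii) If $a$ is rational and $b$ is irrational, then $\mathrm{OC}(x+\Gamma)=\langle T_{1,-1}\rangle$ if $2a\in\mathbb{Z}$, and $\mathrm{OC}(x+\Gamma)=\{\mathbf{1}\}$ otherwise. (iii) If both $a$ and $b$ are irrational, then: (a) if $1$, $a$, $b$ are rationally independent, then $\mathrm{OC}(x+\Gamma)=\{\mathbf{1}\}$; (b) if $a=\frac{p_1}{q_1}+\frac{p_2}{q_2}b$, where $p_j,q_j\in\mathbb{Z}$ ($q_j\ne 0$) and $p_j$ is relatively prime to $q_j$ for $j\in\{1,2\}$, then 1. if $p_2q_2$ is even, $\mathrm{OC}(x+\Gamma)=\langle T_{p_2+q_2i,\,1}\rangle$ if $q_1\mid 2q_2$, and $\mathrm{OC}(x+\Gamma)=\{\mathbf{1}\}$ otherwise; 2. if $p_2q_2$ is odd, $\mathrm{OC}(x+\Gamma)=\langle T_{(p_2+q_2)/2-(p_2-q_2)i/2,\; i}\rangle$ if $q_1\mid q_2$, and $\mathrm{OC}(x+\Gamma)=\{\mathbf{1}\}$ otherwise.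
   Context: $\mathbb{R}^2$ is identified with $\mathbb{C}$, and $\Gamma=\mathbb{Z}[i]$ is the square lattice. For $x\in\mathbb{C}$, a cosublattice of the shifted lattice $x+\Gamma$ is a subset $x+\ell+\Gamma'$ with $\ell\in\Gamma$ and $\Gamma'$ a finite index subgroup of $\Gamma$; $\mathrm{OC}(x+\Gamma)$ is the set of all $R\in \mathrm{O}(2)$ (linear isometries of $\mathbb{C}$) such that $(x+\Gamma)\cap R(x+\Gamma)$ is a cosublattice of $x+\Gamma$. $T_r$ denotes the reflection $w\mapsto \overline{w}$ (complex conjugation), and $\mathbf{1}$ the identity. For a unit $\varepsilon\in\{\pm1,\pm i\}$ and $z\in\mathbb{Z}[i]$ nonzero and relatively prime to $\overline{z}$, $R_{z,\varepsilon}$ denotes the rotation $w\mapsto \varepsilon\frac{z}{\overline z}w$, and $T_{z,\varepsilon}:=R_{z,\varepsilon}\circ T_r$, i.e. $w\mapsto\varepsilon\frac{z}{\overline z}\overline{w}$. $\langle T\rangle$ denotes the group generated by $T$. The term ''group'' is with respect to composition. *)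

(* Defs.v *)
From HB Require Import structures.
From mathcomp Require Export all_boot all_order all_algebra.
From mathcomp Require Export boolp classical_sets functions cardinality reals.
From mathcomp Require Export complex.
Set Implicit Arguments.
Unset Strict Implicit.
Unset Printing Implicit Defensive.
Import Order.TTheory GRing.Theory Num.Theory.

Local Open Scope classical_set_scope.
Local Open Scope ring_scope.
Local Open Scope complex_scope.

Definition gauss_int {R : realType} : set R[i] :=
  [set z | complex.Re z \is a Num.int /\ complex.Im z \is a Num.int].

Definition gauss_dvd {R : realType} (d z : R[i]) : Prop :=
  exists2 k, gauss_int k & z = d * k.

Definition gauss_unit {R : realType} (d : R[i]) : Prop :=
  exists2 e, gauss_int e & d * e = 1.

Definition gauss_coprime {R : realType} (z w : R[i]) : Prop :=
  forall d, gauss_int d -> gauss_dvd d z -> gauss_dvd d w -> gauss_unit d.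

Definition translate {V : zmodType} (x : V) (L : set V) : set V :=
  [set x + l | l in L].

Definition finite_index_subgroup {V : zmodType} (L G : set V) : Prop :=
  [/\ L `<=` G, zmod_closed (mem L) & finite_set [set translate g L | g in G]].

Definition cosublattice {R : realType} (x : R[i]) (S : set R[i]) : Prop :=
  exists l L, [/\ gauss_int l, finite_index_subgroup L gauss_int
                & S = translate (x + l) L].

(* The scalar k is real: the library predicate [linear], read on R[i], would
   mean C-linearity and exclude the reflections. *)
Definition linear_isometry {R : realType} (f : R[i] -> R[i]) : Prop :=
  (forall (k : R) z w, f (k%:C * z + w) = k%:C * f z + f w) /\
  (forall z w, `|f z - f w| = `|z - w|).

Definition OC {R : realType} (x : R[i]) : set (R[i] -> R[i]) :=
  [set f | linear_isometry f /\
    cosublattice x (translate x gauss_int `&` f @` translate x gauss_int)].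

Definition composition_group {T : Type} (G : set (T -> T)) : Prop :=
  [/\ G id, (forall f g, G f -> G g -> G (f \o g))
    & forall f, G f -> exists2 g, G g & f \o g = id /\ g \o f = id].

Definition generated {T : Type} (f : T -> T) : set (T -> T) :=
  smallest composition_group [set f].

(* [rotation z eps] and [reflection z eps] are total in z; they are the maps
   R_{z,eps} and T_{z,eps} when z is an admissible parameter and eps a unit. *)
Definition admissible {R : realType} (z : R[i]) : Prop :=
  [/\ gauss_int z, z != 0 & gauss_coprime z (conjc z)].

Definition rotation {R : realType} (z eps : R[i]) : R[i] -> R[i] :=
  fun w => eps * (z / conjc z) * w.

Definition reflection {R : realType} (z eps : R[i]) : R[i] -> R[i] :=
  rotation z eps \o conjc.

Definition rationally_independent {R : realType} {n : nat} (v : n.-tuple R)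
    : Prop :=
  forall c : 'I_n -> rat,
    \sum_(i < n) ratr (c i) * tnth v i = 0 -> forall i, c i = 0.

(* Main.v *)
From HB Require Import structures.
Require Import Defs.
From mathcomp Require Import ring lra.
Import Order.TTheory GRing.Theory Num.Theory.

(** Write G for Z[i] and Q(i) for its field of fractions. A linear isometry of
the plane is w |-> u w or w |-> u conj(w) with |u| = 1, and it lies in
OC(x + G) exactly when u is in Q(i) and some point x + l of the shifted
lattice is the image of another one x + m ([OC_orthogonal_mapP]): a finite
index subgroup of G contains a positive integer n, which then has the form
u g with g in G; conversely, if u is in Q(i), a common denominator N of u
gives N G inside the intersection of G with its image, so this intersection
has finite index, and the coincidence set is its translate through x + l.

Suppose now that x is not in Q(i). For a rotation, x + l = u (x + m) puts
(1 - u) x in Q(i), so u = 1. For a reflection, the condition says that the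
defect x - u conj(x) lies in G + u G. If the defects for u and for v both lie
in Q(i), so does (v - u) conj(x), and u = v: there is at most one candidate u
with defect in Q(i), and OC(x + G) is generated by its reflection or trivial
according to whether the defect is in G + u G ([OC_reflect_dichotomy]). When
1, a, b are rationally independent there is no candidate at all.

In the remaining cases the candidate is u = eps z / conj(z), with z and
conj(z) generating the unit ideal of G. Multiplying by conj(z) turns G + u G
into z G + conj(z) G = G, so what has to be tested is whether
conj(z) x - eps z conj(x) is in G ([OC_reflection]). This number is 2 b i
for z = eps = 1, it is 2 a for z = 1 and eps = -1, and on the line
a = rho + (p2 / q2) b, with rho = p1 / q1, it is - 2 q2 rho i for
z = p2 + q2 i and eps = 1, and q2 rho (1 - i) when z is divided by 1 + i and
eps = i. The b-terms cancel because z is parallel to the direction of the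
line. Finally z = m + n i and conj(z) are comaximal when m, n are coprime of
different parities: the ideal contains 2 m and 2 n, hence 2, and the odd
number m^2 + n^2. *)

Set Implicit Arguments.
Unset Strict Implicit.
Unset Printing Implicit Defensive.

Local Open Scope classical_set_scope.
Local Open Scope ring_scope.
Local Open Scope complex_scope.

(** * Rational, Gaussian and Gaussian rational numbers *)

(** A boolean copy of the set of rationals, so that its closure properties can
be inferred. *)
Definition rational_pred {R : realType} : {pred R} :=
  fun r => r \in (rational : set R).

Lemma rationalP {R : realType} (r : R) : rational r <-> r \in rational_pred.
Proof. by rewrite unfold_in; split=> [/mem_set|/set_mem]. Qed.

Lemma rational_ratr {R : realType} (q : rat) : (ratr q : R) \in rational_pred.
Proof. by apply/rationalP; exists q. Qed.

Fact rational_divring_closed {R : realType} :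
  divring_closed (@rational_pred R).
Proof.
split=> [|x y|x y].
- by rewrite -(rmorph1 (@ratr R)); exact: rational_ratr.
- move=> /rationalP[p _ <-] /rationalP[q _ <-].
  by rewrite -rmorphB; exact: rational_ratr.
- move=> /rationalP[p _ <-] /rationalP[q _ <-].
  by rewrite -fmorph_div; exact: rational_ratr.
Qed.

HB.instance Definition _ (R : realType) :=
  GRing.isDivringClosed.Build R rational_pred rational_divring_closed.

Definition gaussian {R : realType} : {pred R[i]} :=
  fun z => (complex.Re z \is a Num.int) && (complex.Im z \is a Num.int).

Definition gaussian_rational {R : realType} : {pred R[i]} :=
  fun z => (complex.Re z \in rational_pred) && (complex.Im z \in rational_pred).

Lemma gaussianE {R : realType} (a b : R) :
  (a +i* b \in gaussian) = (a \is a Num.int) && (b \is a Num.int).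
Proof. by []. Qed.

Lemma gaussian_rationalE {R : realType} (a b : R) :
  (a +i* b \in gaussian_rational) =
  (a \in rational_pred) && (b \in rational_pred).
Proof. by []. Qed.

Lemma gauss_intP {R : realType} (z : R[i]) : gauss_int z <-> z \in gaussian.
Proof. by split=> [[Hre Him]|/andP[]//]; apply/andP. Qed.

Fact gaussian_subring_closed {R : realType} : subring_closed (@gaussian R).
Proof.
split=> [|[a b] [c d]|[a b] [c d]]; rewrite ?gaussianE.
- by apply/andP; split; [exact: rpred1|exact: rpred0].
- by move=> /andP[Ha Hb] /andP[Hc Hd]; apply/andP; rewrite !rpredB.
- move=> /andP[Ha Hb] /andP[Hc Hd]; apply/andP.
  by rewrite rpredB ?rpredD ?rpredM.
Qed.

HB.instance Definition _ (R : realType) :=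
  GRing.isSubringClosed.Build R[i] gaussian gaussian_subring_closed.

Fact gaussian_rational_divring_closed {R : realType} :
  divring_closed (@gaussian_rational R).
Proof.
split=> [|[a b] [c d]|[a b] [c d]]; rewrite ?gaussian_rationalE.
- by apply/andP; split; [exact: rpred1|exact: rpred0].
- by move=> /andP[Ha Hb] /andP[Hc Hd]; apply/andP; rewrite !rpredB.
- move=> /andP[Ha Hb] /andP[Hc Hd].
  have Hn : (c ^+ 2 + d ^+ 2)^-1 \in rational_pred.
    by rewrite rpredV rpredD ?rpredX.
  have Hc' : c / (c ^+ 2 + d ^+ 2) \in rational_pred by rewrite rpredM.
  have Hd' : - (d / (c ^+ 2 + d ^+ 2)) \in rational_pred.
    by rewrite rpredN rpredM.
  by apply/andP; rewrite rpredB ?rpredD ?rpredM.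
Qed.

HB.instance Definition _ (R : realType) :=
  GRing.isDivringClosed.Build R[i] gaussian_rational
    gaussian_rational_divring_closed.

Lemma gaussian_conj {R : realType} (z : R[i]) :
  (conjc z \in gaussian) = (z \in gaussian).
Proof. by case: z => a b; rewrite !gaussianE rpredN. Qed.

Lemma gaussian_rational_conj {R : realType} (z : R[i]) :
  (conjc z \in gaussian_rational) = (z \in gaussian_rational).
Proof. by case: z => a b; rewrite !gaussian_rationalE rpredN. Qed.

Lemma gaussian_i {R : realType} : 'i \in @gaussian R.
Proof. by rewrite gaussianE rpred0 rpred1. Qed.

Lemma rational_int {R : realType} (r : R) :
  r \is a Num.int -> r \in rational_pred.
Proof. by move=> /intrP[n ->]; rewrite rpred_int. Qed.

Lemma gaussianW {R : realType} (z : R[i]) :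
  z \in gaussian -> z \in gaussian_rational.
Proof. by move=> /andP[? ?]; apply/andP; split; apply: rational_int. Qed.

Lemma natrc {R : realType} (n : nat) : (n%:R : R[i]) = n%:R%:C.
Proof. by rewrite rmorph_nat. Qed.

Lemma rational_denominator {R : realType} (r : R) : r \in rational_pred ->
  exists2 n : nat, (0 < n)%N & n%:R * r \is a Num.int.
Proof.
move=> /rationalP[q _ <-]; exists `|denq q|%N.
  by rewrite absz_gt0 denq_eq0.
have -> : (`|denq q|%N%:R : R) = ratr (denq q)%:~R.
  by rewrite ratr_int -[in RHS]absz_denq.
by rewrite -rmorphM mulrC -numqE rmorph_int rpred_int.
Qed.

Lemma gaussian_rational_denominator {R : realType} (z : R[i]) :
  z \in gaussian_rational ->
  exists2 n : nat, (0 < n)%N & n%:R * z \in gaussian.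
Proof.
case: z => a b /andP[/= /rational_denominator[n n0 na]].
move=> /rational_denominator[m m0 mb]; exists (n * m)%N.
  by rewrite muln_gt0 n0.
rewrite natrc.
have -> : (n * m)%:R%:C * (a +i* b) =
    (m%:R * (n%:R * a)) +i* (n%:R * (m%:R * b)) :> R[i].
  by rewrite natrM; apply/eqP; rewrite eq_complex /=; apply/andP; split;
    apply/eqP; ring.
by apply/andP; split; apply: rpredM; rewrite ?rpred_nat.
Qed.

(** * Finite index subgroups *)

Section FiniteIndex.
Variable V : zmodType.
Implicit Types (L G : set V) (g h v : V).

Lemma eq_translate L g h (Lz : zmod_closed (mem L)) :
  translate g L = translate h L <-> L (g - h).
Proof.
have [L0 LB] := Lz; have L0' : L 0 by apply/set_mem.
have LB' v w : L v -> L w -> L (v - w).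
  by move=> /mem_set Lv /mem_set Lw; apply/set_mem/LB.
have sub v w : L (v - w) -> translate v L `<=` translate w L.
  move=> Lvw _ [l Ll <-]; exists (v - w + l); last by rewrite addrA subrKC.
  by rewrite -[l]opprK -[- l]sub0r; apply: (LB') => //; apply: (LB').
split=> [E|Lgh].
  have : translate g L g by exists 0; rewrite ?addr0.
  by rewrite E => -[l Ll <-]; rewrite addrAC subrr add0r.
apply/seteqP; split; apply: sub => //.
by rewrite -opprB -sub0r; apply: (LB').
Qed.

(** Pigeonhole on the cosets of the multiples of g. *)
Lemma finite_index_multiple L G g :
  finite_index_subgroup L G -> (forall n : nat, G (g *+ n)) ->
  exists2 n : nat, (0 < n)%N & L (g *+ n).
Proof.
move=> [_ Lz finL] Gg; apply: contrapT => no_multiple.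
apply: infinite_nat.
pose c (n : nat) := translate (g *+ n) L.
suff c_inj : injective c.
  have /eq_finite_set <- : (c @` setT #= [set: nat])%card.
    by apply: inj_card_eq => m n _ _; exact: c_inj.
  by apply: sub_finite_set finL => _ [n _ <-]; exists (g *+ n).
have c_inj_lt m n : c m = c n -> (n <= m)%N -> m = n.
  move=> /(eq_translate _ _ Lz) Lmn nm; apply: contrapT => /eqP m_n.
  case: no_multiple; exists (m - n)%N; last by rewrite mulrnBr.
  by rewrite subn_gt0 ltn_neqAle eq_sym m_n.
move=> m n E; case: (leqP n m) => [/(c_inj_lt _ _ E)//|/ltnW nm].
by apply/esym/c_inj_lt.
Qed.

End FiniteIndex.

(** The coset of m + n i depends only on the residues of m and n modulo N. *)
Lemma gaussian_finite_index {R : realType} (L : set R[i]) (N : nat) :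
  (0 < N)%N -> L `<=` gauss_int -> zmod_closed (mem L) ->
  (forall g, g \in gaussian -> L (N%:R * g)) ->
  finite_index_subgroup L gauss_int.
Proof.
move=> N0 LG Lz LN; split=> //.
have NZ0 : (N : int) != 0 by rewrite eqz_nat -lt0n.
pose c (i j : nat) : set R[i] := translate (i%:R +i* j%:R) L.
apply: sub_finite_set (finite_image2 c (finite_II N) (finite_II N)).
move=> _ [[a b] [/intrP[m /= ->] /intrP[n /= ->]] <-].
have rem (k : int) : exists2 r : nat, (r < N)%N & (r%:Z = (k %% N)%Z).
  exists `|(k %% N)%Z|%N; last by rewrite gez0_abs ?modz_ge0.
  by rewrite -ltz_nat gez0_abs ?modz_ge0 // ltz_pmod.
have [r rN Er] := rem m; have [s sN Es] := rem n.
exists r => //; exists s => //; apply/(eq_translate _ _ Lz).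
have -> : (r%:R +i* s%:R) - (m%:~R +i* n%:~R) =
    N%:R * ((- (m %/ N)%Z%:~R) +i* (- (n %/ N)%Z%:~R)) :> R[i].
  have div (k : int) (t : nat) : t%:Z = (k %% N)%Z ->
      k%:~R = (k %/ N)%Z%:~R * N%:R + t%:R :> R.
    by move=> Et; rewrite [in LHS](divz_eq k N) -Et intrD intrM.
  rewrite natrc (div _ _ Er) (div _ _ Es); apply/eqP; rewrite eq_complex /=.
  by apply/andP; split; apply/eqP; ring.
by apply: LN; rewrite unfold_in /= !rpredN !rpred_int.
Qed.

(** * Linear isometries of the complex plane *)

Definition conj_if {R : realType} (c : bool) (w : R[i]) : R[i] :=
  if c then conjc w else w.

(** Indexing the two components of the orthogonal group by a boolean lets
rotations and reflections share the analysis of coincidences. *)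
Definition orthogonal_map {R : realType} (c : bool) (u : R[i]) : R[i] -> R[i] :=
  fun w => u * conj_if c w.

Section OrthogonalMaps.
Variable R : realType.
Implicit Types (u v w x z : R[i]) (c : bool).

Lemma conj_ifB c z w : conj_if c (z - w) = conj_if c z - conj_if c w.
Proof. by case: c; rewrite //= rmorphB. Qed.

Lemma conj_ifD c z w : conj_if c (z + w) = conj_if c z + conj_if c w.
Proof. by case: c; rewrite //= rmorphD. Qed.

Lemma conj_ifM c z w : conj_if c (z * w) = conj_if c z * conj_if c w.
Proof. by case: c; rewrite //= rmorphM. Qed.

Lemma conj_ifK c : involutive (@conj_if R c).
Proof. by case: c => // z; apply: conjcK. Qed.

Lemma conj_if_real c (k : R) : conj_if c k%:C = k%:C.
Proof. by case: c; rewrite //= oppr0. Qed.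

Lemma conj_if_gaussian c z : (conj_if c z \in gaussian) = (z \in gaussian).
Proof. by case: c; rewrite //= gaussian_conj. Qed.

Lemma conj_if_gaussian_rational c z :
  (conj_if c z \in gaussian_rational) = (z \in gaussian_rational).
Proof. by case: c; rewrite //= gaussian_rational_conj. Qed.

Lemma unit_circleP u : (`|u| = 1) <-> (u * conjc u = 1).
Proof.
rewrite -sqr_normc; split=> [->|/eqP]; first by rewrite expr1n.
by rewrite sqrf_eq1 => /orP[/eqP//|/eqP u1]; have := normr_ge0 u;
  rewrite u1 ler0N1.
Qed.

Lemma orthogonal_map_isometry c u :
  u * conjc u = 1 -> linear_isometry (orthogonal_map c u).
Proof.
move=> u1; split=> [k z w|z w].
  rewrite /orthogonal_map conj_ifD conj_ifM conj_if_real; ring.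
rewrite /orthogonal_map -mulrBr -conj_ifB normrM.
have /unit_circleP -> := u1; rewrite mul1r.
by case: c => //=; rewrite normcJ.
Qed.

(** The images of 1 and i are two orthogonal unit vectors p + q i and r + s i;
such a frame is determined by the first vector and by the sign k = p s - q r,
which separates rotations from reflections. *)
Lemma linear_isometryP (f : R[i] -> R[i]) : linear_isometry f ->
  exists c u, u * conjc u = 1 /\ f = orthogonal_map c u.
Proof.
move=> [flin fdist].
have f0 : f 0 = 0.
  by have := flin 1 0 0; rewrite !mul1r !addr0 => /eqP;
    rewrite -subr_eq0 opprD addNKr oppr_eq0 => /eqP.
have fE (a b : R) : f (a +i* b) = a%:C * f 1 + b%:C * f 'i.
  have -> : a +i* b = a%:C * 1 + (b%:C * 'i + 0).
    by apply/eqP; rewrite eq_complex /=; apply/andP; split; apply/eqP; ring.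
  by rewrite !flin f0 addr0.
have sqnorm (z w : R[i]) : `|z| = `|w| ->
    complex.Re z ^+ 2 + complex.Im z ^+ 2 =
    complex.Re w ^+ 2 + complex.Im w ^+ 2.
  by move=> zw; apply: (@complexI R); rewrite !add_Re2_Im2 zw.
have := sqnorm _ _ (fdist 1 0); have := sqnorm _ _ (fdist 'i 0).
have := sqnorm _ _ (fdist 1 'i); rewrite f0 !subr0.
case E1 : (f 1) => [p q]; case Ei : (f 'i) => [r s] /=.
rewrite !oppr0 !expr0n !expr1n /= !addr0 !add0r => D N2 N1.
have dot : p * r + q * s = 0 by lra.
pose k := p * s - q * r.
have Er : r = - (k * q).
  apply/eqP; rewrite -subr_eq0 opprK.
  have -> : r + k * q = r * (1 - (p ^+ 2 + q ^+ 2)) + p * (p * r + q * s).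
    by rewrite /k; ring.
  by rewrite N1 dot subrr !mulr0 addr0.
have Es : s = k * p.
  apply/eqP; rewrite -subr_eq0.
  have -> : s - k * p = s * (1 - (p ^+ 2 + q ^+ 2)) + q * (p * r + q * s).
    by rewrite /k; ring.
  by rewrite N1 dot subrr !mulr0 addr0.
(* Lagrange's identity. *)
have : k ^+ 2 = 1.
  have -> : k ^+ 2 = (p ^+ 2 + q ^+ 2) * (r ^+ 2 + s ^+ 2)
                     - (p * r + q * s) ^+ 2 by rewrite /k; ring.
  by rewrite N1 N2 dot expr0n mulr1 subr0.
move=> /eqP; rewrite sqrf_eq1 => k1; exists (k == -1), (p +i* q); split.
  by apply/eqP; rewrite eq_complex /=; apply/andP; split; apply/eqP;
    [rewrite mulrN opprK -N1; ring|ring].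
apply: funext => -[a b]; rewrite fE E1 Ei Er Es /orthogonal_map.
case/orP: k1 => /eqP ->.
  rewrite -subr_eq0 opprK -[1 + 1]/(2%:R) pnatr_eq0 /=.
  by apply/eqP; rewrite eq_complex /=; apply/andP; split; apply/eqP; ring.
rewrite eqxx /=.
by apply/eqP; rewrite eq_complex /=; apply/andP; split; apply/eqP; ring.
Qed.

End OrthogonalMaps.

(** * Coincidence isometries of a shifted square lattice *)

Definition reflect_by {R : realType} (u : R[i]) : R[i] -> R[i] :=
  orthogonal_map true u.

Section Coincidence.
Variable R : realType.
Implicit Types (u v w x z : R[i]) (c : bool).

(** The subgroup underlying the coincidence set is the intersection of Z[i] with
its image, whatever the shift x; the shift only decides whether the
intersection is empty. *)
Lemma OC_orthogonal_mapP c u x : u * conjc u = 1 ->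
  OC x (orthogonal_map c u) <->
  u \in gaussian_rational /\
  exists l m, [/\ l \in gaussian, m \in gaussian
                & x + l = orthogonal_map c u (x + m)].
Proof.
move=> u1; set f := orthogonal_map c u.
have fB z w : f (z - w) = f z - f w.
  by rewrite /f /orthogonal_map conj_ifB mulrBr.
split=> [[_ [l [L [/gauss_intP lG Lfin Ecap]]]]|[uQ [l [m [lG mG xlm]]]]].
  have [_ Lz _] := Lfin.
  have capL v : L v -> exists2 g, g \in gaussian & x + l + v = f (x + g).
    move=> Lv; have : translate (x + l) L (x + l + v) by exists v.
    by rewrite -Ecap => -[_ [_ [g /gauss_intP gG <-] <-]]; exists g.
  have [m mG xlm] : exists2 m, m \in gaussian & x + l = f (x + m).
    have [|m mG E] := @capL 0; first by case: Lz => /set_mem.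
    by exists m; rewrite // -E addr0.
  split; last by exists l, m.
  have [|n n0 /capL[g gG xln]] := finite_index_multiple (g := 1) Lfin.
    by move=> n; apply/gauss_intP; rewrite rpredMn ?rpred1.
  (* Subtracting the equations for x + l + n and x + l eliminates x. *)
  have En : n%:R = u * conj_if c (g - m).
    have -> : n%:R = x + l + n%:R - (x + l) by rewrite [x + l + _]addrC addrK.
    by rewrite xln xlm -fB [x + g]addrC addrKA.
  have nz : (n%:R : R[i]) != 0 by rewrite pnatr_eq0 -lt0n.
  have gm0 : conj_if c (g - m) != 0.
    by apply: contra_neq nz => E; rewrite En E mulr0.
  rewrite -[u](mulfK gm0) -En rpred_div ?rpred_nat //.
  by rewrite conj_if_gaussian_rational gaussianW ?rpredB.
split; first exact: orthogonal_map_isometry.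
pose L :=
  [set v : R[i] | v \in gaussian /\ exists2 g, g \in gaussian & v = f g].
have Lz : zmod_closed (mem L).
  split=> [|v w /set_mem[vG [g gG vg]] /set_mem[wG [h hG wh]]]; apply/mem_set.
    split; first exact: rpred0.
    by exists 0; rewrite ?rpred0 // -[0 in RHS](subrr 0) fB subrr.
  split; first exact: rpredB.
  by exists (g - h); rewrite ?rpredB // fB -vg -wh.
exists l, L; split; first exact/gauss_intP.
  (* A multiple n g is the image of the conjugate of n u, times g, because the
     inverse of u is its conjugate. *)
  have [n n0 nuG] := gaussian_rational_denominator uQ.
  apply: (gaussian_finite_index n0) Lz _ => [v [vG _]|g gG].
    exact/gauss_intP.
  split; first by rewrite rpredM ?rpred_nat.
  exists (conj_if c (conjc (n%:R * u) * g)).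
    by rewrite conj_if_gaussian rpredM ?gaussian_conj.
  rewrite /f /orthogonal_map conj_ifK rmorphM /= conjc_nat.
  by rewrite -mulrA [u * _]mulrC -!mulrA [g * u]mulrC [conjc u * _]mulrA
    [conjc u * u]mulrC u1 mul1r.
apply/seteqP; split=> [y [[g /gauss_intP gG <-]]|_ [v [vG [g gG vfg]] <-]].
  move=> [_ [h /gauss_intP hG <-] fh].
  exists (g - l); last by rewrite addrACA subrr addr0.
  split; first exact: rpredB.
  exists (h - m); first exact: rpredB.
  have -> : g - l = x + g - (x + l) by rewrite opprD addrACA subrr add0r.
  by rewrite -fh xlm -fB opprD addrACA subrr add0r.
split; first by exists (l + v); rewrite ?addrA //; apply/gauss_intP/rpredD.
exists (x + (m + g)); first by exists (m + g) => //; apply/gauss_intP/rpredD.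
have fD z w : f (z + w) = f z + f w.
  by rewrite /f /orthogonal_map conj_ifD mulrDr.
by rewrite addrA fD -xlm vfg.
Qed.

Lemma orthogonal_map_id : orthogonal_map false 1 = id :> (R[i] -> R[i]).
Proof. by apply: funext => w; rewrite /orthogonal_map mul1r. Qed.

Lemma OC_id x : OC x id.
Proof.
rewrite -orthogonal_map_id; apply/OC_orthogonal_mapP.
  by rewrite conjc1 mul1r.
split; first exact: rpred1.
by exists 0, 0; rewrite rpred0 orthogonal_map_id.
Qed.

(** A rotation by u other than 1 would give (1 - u) x = u m - l, putting x in
Q(i). *)
Lemma OC_elim x f : x \notin gaussian_rational -> OC x f ->
  f = id \/ exists u, u * conjc u = 1 /\ f = reflect_by u.
Proof.
move=> xQ OCf; have [fiso _] := OCf.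
have [[] [u [u1 Ef]]] := linear_isometryP fiso.
  by right; exists u.
left; move: OCf; rewrite Ef => /(OC_orthogonal_mapP _ _ u1).
move=> [uQ [l [m [lG mG]]]]; rewrite /orthogonal_map /= => E.
have [->|u_neq1] := eqVneq u 1; first exact: orthogonal_map_id.
case/negP: xQ; have u1' : 1 - u != 0 by rewrite subr_eq0 eq_sym.
have -> : x = (u * m - l) / (1 - u).
  apply: (canRL (mulfK u1')).
  by rewrite mulrBr mulr1 {1}(canRL (addrK l) E); ring.
by rewrite rpred_div ?rpredB ?rpredM ?rpred1 // gaussianW.
Qed.

(** How far x is from being fixed by the reflection. *)
Definition reflection_defect u x := x - u * conjc x.

(** Because conj permutes Z[i], the equation x + l = u conj(x + m) only depends
on the class of the defect modulo Z[i] + u Z[i]. *)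
Lemma OC_reflectP u x : u * conjc u = 1 -> u \in gaussian_rational ->
  OC x (reflect_by u) <->
  exists g h, [/\ g \in gaussian, h \in gaussian
                & reflection_defect u x = g + u * h].
Proof.
move=> u1 uQ; split.
  move=> /(OC_orthogonal_mapP _ _ u1)[_ [l [m [lG mG E]]]].
  exists (- l), (conjc m); rewrite rpredN gaussian_conj; split=> //.
  move: E; rewrite /orthogonal_map /= rmorphD /= mulrDr /reflection_defect => E.
  by rewrite {1}(canRL (addrK l) E); ring.
move=> [g [h [gG hG E]]]; apply/(OC_orthogonal_mapP _ _ u1); split=> //.
exists (- g), (conjc h); rewrite rpredN gaussian_conj; split=> //.
rewrite /orthogonal_map /= rmorphD /= conjcK mulrDr.
by rewrite {1}(canRL (subrK _) E); ring.
Qed.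

Lemma OC_reflect_rational u x : u * conjc u = 1 -> OC x (reflect_by u) ->
  u \in gaussian_rational /\ reflection_defect u x \in gaussian_rational.
Proof.
move=> u1 OCu; have [uQ _] := (OC_orthogonal_mapP true x u1).1 OCu.
split=> //; have [g [h [gG hG ->]]] := (OC_reflectP x u1 uQ).1 OCu.
by rewrite rpredD ?rpredM // gaussianW.
Qed.

(** The difference of two defects is (v - u) conj(x). *)
Lemma reflection_defect_inj u v x : x \notin gaussian_rational ->
  u \in gaussian_rational -> v \in gaussian_rational ->
  reflection_defect u x \in gaussian_rational ->
  reflection_defect v x \in gaussian_rational -> u = v.
Proof.
move=> xQ uQ vQ Du Dv; apply: contraNeq xQ => uv.
have uv0 : v - u != 0 by rewrite subr_eq0 eq_sym.
rewrite -gaussian_rational_conj.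
have -> : conjc x = (reflection_defect u x - reflection_defect v x) / (v - u).
  by apply: (canRL (mulfK uv0)); rewrite /reflection_defect; ring.
by apply: rpred_div; apply: rpredB.
Qed.

Lemma composition_group_involution (T : Type) (f : T -> T) :
  involutive f -> composition_group [set id; f].
Proof.
move=> fK; have ff : f \o f = id by apply: funext => t /=; rewrite fK.
split; first by left.
  by move=> g h [->|->] [->|->]; rewrite ?ff; [left|right|right|left].
by move=> g [->|->]; [exists id; [left|]|exists f; [right|rewrite ff]].
Qed.

Lemma generated_involution (T : Type) (f : T -> T) :
  involutive f -> generated f = [set id; f].
Proof.
move=> fK; apply/seteqP; split=> [g|g [->|->] G [[G1 _ _] fG]].
- apply; split; first exact: composition_group_involution.
  by move=> _ ->; right.
- exact: G1.
- exact: fG.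
Qed.

Lemma reflect_byK u : u * conjc u = 1 -> involutive (reflect_by u).
Proof.
move=> u1 w; rewrite /reflect_by /orthogonal_map /= rmorphM /= conjcK.
by rewrite mulrA u1 mul1r.
Qed.

(** The candidate u can be found by linear algebra over Q, from its defect being
in Q(i); by uniqueness it then suffices to test that single reflection. *)
Lemma OC_reflect_dichotomy u x : x \notin gaussian_rational ->
  u * conjc u = 1 -> u \in gaussian_rational ->
  reflection_defect u x \in gaussian_rational ->
  (OC x (reflect_by u) -> OC x = generated (reflect_by u)) /\
  (~ OC x (reflect_by u) -> OC x = [set id]).
Proof.
move=> xQ u1 uQ Du.
have OCsub f : OC x f -> f = id \/ f = reflect_by u /\ OC x (reflect_by u).
  move=> OCf; have [->|[v [v1 Ef]]] := OC_elim xQ OCf; [by left|right].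
  move: OCf; rewrite Ef => OCv; have [vQ Dv] := OC_reflect_rational v1 OCv.
  by rewrite (reflection_defect_inj xQ uQ vQ Du Dv).
split=> OCu.
  rewrite (generated_involution (reflect_byK u1)).
  apply/seteqP; split=> [f /OCsub[->|[-> _]]|f [->|->]] //; [by left|by right|].
  exact: OC_id.
apply/seteqP; split=> [f /OCsub[->//|[_ /OCu]//]|_ ->]; exact: OC_id.
Qed.

Lemma OC_cases x : x \notin gaussian_rational ->
  OC x = [set id] \/
  exists u, [/\ u * conjc u = 1, u \in gaussian_rational,
                reflection_defect u x \in gaussian_rational
              & OC x = generated (reflect_by u)].
Proof.
move=> xQ.
have [[u [u1 OCu]]|no_refl] :=
    pselect (exists u, u * conjc u = 1 /\ OC x (reflect_by u)).
  have [uQ Du] := OC_reflect_rational u1 OCu.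
  by right; exists u; split=> //; apply: (OC_reflect_dichotomy xQ u1 uQ Du).1.
left; apply/seteqP; split=> [f OCf|_ ->]; last exact: OC_id.
have [->//|[u [u1 Ef]]] := OC_elim xQ OCf.
by case: no_refl; exists u; rewrite -Ef.
Qed.

Lemma OC_group_card x : x \notin gaussian_rational ->
  composition_group (OC x) /\ (OC x #<= `I_2)%card.
Proof.
have two (f : R[i] -> R[i]) : ([set id; f] #<= `I_2)%card.
  pose g (n : nat) := if n == 0%N then id else f.
  have -> : [set id; f] = g @` `I_2.
    apply/seteqP; split=> [h [->|->]|_ [[|[|n]]//= _ <-]].
    - by exists 0%N.
    - by exists 1%N.
    - by left.
    - by right.
  exact: card_image_le.
have id_inv : involutive (@id R[i]) by [].
move=> /OC_cases[->|[u [u1 _ _ ->]]].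
  have -> : [set @id R[i]] = [set id; id] by rewrite setUid.
  by split; [exact: composition_group_involution|exact: two].
rewrite (generated_involution (reflect_byK u1)).
by split; [exact: composition_group_involution (reflect_byK u1)|exact: two].
Qed.

End Coincidence.

(** * Reflections z / conj(z) with z and its conjugate comaximal *)

Section Arithmetic.
Variable R : realType.
Implicit Types (z k l eps x t : R[i]) (m n p q : int).

(** The Bezout form of the coprimality of z and conj(z): this is the form that
the coincidence condition uses, and explicit identities give it directly. *)
Definition conj_comaximal z : Prop :=
  exists k l, [/\ k \in gaussian, l \in gaussian & z * k + conjc z * l = 1].

Lemma conj_comaximal1 : conj_comaximal 1.
Proof.
by exists 1, 0; split; rewrite ?rpred0 ?rpred1 // mulr0 addr0 mulr1.
Qed.

Lemma odd_intP m : reflect (exists s, m = 2 * s + 1) (~~ (2 %| m)%Z).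
Proof.
apply: (iffP idP) => [odd_m|[s ->]].
  exists (m %/ 2)%Z; rewrite [LHS](divz_eq _ 2) mulrC; congr (_ + _).
  have := contra (introT dvdz_mod0P \o eqP) odd_m.
  have := modz_ge0 m (isT : 2 != 0 :> int).
  have := ltz_pmod m (isT : 0 < 2 :> int).
  by case: (m %% 2)%Z => [[|[|]]|].
by rewrite rpredDl ?dvdz_mulr.
Qed.

(** The squares p^2 = p (p + q) - p q and q^2 = q (p + q) - p q, hence also
1 = (u p + v q)^2, are combinations of p + q and p q. *)
Lemma coprimez_sum_odd p q :
  coprimez p q -> (2 %| p * q)%Z -> ~~ (2 %| p + q)%Z.
Proof.
move=> /coprimezP[[u v] /= B] ev_mul; apply/negP => ev_add.
suff : (2 %| 1)%Z by [].
have -> : 1 = (u ^+ 2 * p + v ^+ 2 * q) * (p + q)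
              + (2 * u * v - u ^+ 2 - v ^+ 2) * (p * q) :> int.
  by transitivity ((u * p + v * q) ^+ 2); [rewrite B expr1n|ring].
by apply: rpredD; apply: dvdz_mull.
Qed.

Lemma odd_int_mul p q : ~~ (2 %| p * q)%Z -> ~~ (2 %| p)%Z /\ ~~ (2 %| q)%Z.
Proof.
move=> odd_pq; split; apply: contra odd_pq => ?; first exact: dvdz_mulr.
exact: dvdz_mull.
Qed.

(** With u m + v n = 1, the element u (z + conj z) - i v (z - conj z) equals 2,
and z conj(z) = m^2 + n^2 is odd, say 2 t + 1; subtracting t times the former
from the latter gives 1. *)
Lemma conj_comaximal_coprime m n : coprimez m n -> ~~ (2 %| m + n)%Z ->
  conj_comaximal (m%:~R +i* n%:~R).
Proof.
move=> /coprimezP[[u v] /= Bmn] odd_mn.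
have [t Et] : exists t : int, m ^+ 2 + n ^+ 2 = 2 * t + 1.
  have [s Es] := elimT (odd_intP _) odd_mn.
  exists (2 * s ^+ 2 + 2 * s - m * n).
  have -> : m ^+ 2 + n ^+ 2 = (m + n) ^+ 2 - 2 * (m * n) by ring.
  by rewrite Es; ring.
pose z : R[i] := m%:~R +i* n%:~R.
pose U : R[i] := u%:~R; pose V : R[i] := v%:~R; pose T : R[i] := t%:~R.
exists (conjc z - T * (U - 'i * V)), (- T * (U + 'i * V)).
have int_gauss (j : int) : (j%:~R : R[i]) \in gaussian by rewrite rpred_int.
have zG : z \in gaussian by rewrite gaussianE !rpred_int.
have UG : U \in gaussian by exact: int_gauss.
have TG : T \in gaussian by exact: int_gauss.
have VG : V \in gaussian by exact: int_gauss.
have iVG : 'i * V \in gaussian by rewrite rpredM ?gaussian_i.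
split.
- by rewrite rpredB ?gaussian_conj // rpredM ?rpredB.
- by rewrite rpredM ?rpredN ?rpredD.
have intc (j : int) : (j%:~R : R[i]) = j%:~R%:C by rewrite rmorph_int.
have N1 : (m%:~R ^+ 2 + n%:~R ^+ 2 : R) = 2 * t%:~R + 1.
  by rewrite -!rmorphXn -intrD Et intrD intrM.
have B1 : (u%:~R * m%:~R + v%:~R * n%:~R : R) = 1.
  by rewrite -!intrM -intrD Bmn.
rewrite /U /V /T !intc; apply/eqP; rewrite eq_complex /=.
apply/andP; split; apply/eqP; last by ring.
transitivity (m%:~R ^+ 2 + n%:~R ^+ 2 -
              2 * t%:~R * (u%:~R * m%:~R + v%:~R * n%:~R) : R); first by ring.
by rewrite N1 B1; ring.
Qed.

Lemma conj_comaximal_neq0 z : conj_comaximal z -> z != 0.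
Proof.
move=> [k [l [_ _ E]]]; apply: contra_eq_neq E => ->.
by rewrite conjc0 !mul0r addr0 eq_sym oner_eq0.
Qed.

Lemma conj_comaximal_admissible z :
  z \in gaussian -> conj_comaximal z -> admissible z.
Proof.
move=> zG zmax; split; [exact/gauss_intP|exact: conj_comaximal_neq0|].
have [k [l [kG lG E]]] := zmax.
move=> d dG [v /gauss_intP vG Ev] [w /gauss_intP wG Ew].
exists (v * k + w * l); first by apply/gauss_intP; rewrite rpredD ?rpredM.
by rewrite mulrDr !mulrA -Ev -Ew.
Qed.

Lemma reflectionE z eps : reflection z eps = reflect_by (eps * (z / conjc z)).
Proof. by []. Qed.

(** Multiplication by conj(z) maps Z[i] + u Z[i] onto z Z[i] + conj(z) Z[i],
which is Z[i], and maps the defect to t. *)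
Lemma OC_reflection z eps x t : z \in gaussian -> conj_comaximal z ->
  eps \in gaussian -> eps * conjc eps = 1 -> x \notin gaussian_rational ->
  conjc z * x - eps * z * conjc x = t -> t \in gaussian_rational ->
  (t \in gaussian -> OC x = generated (reflection z eps)) /\
  (t \notin gaussian -> OC x = [set id]).
Proof.
move=> zG zmax epsG eps1 xQ Et tQ; rewrite reflectionE.
have z0 := conj_comaximal_neq0 zmax.
have cz0 : conjc z != 0 by rewrite conjc_eq0.
set u := eps * (z / conjc z).
have czG : conjc z \in gaussian by rewrite gaussian_conj.
have u1 : u * conjc u = 1.
  rewrite /u rmorphM /= rmorphM /= conjc_inv conjcK mulrACA eps1 mul1r.
  by rewrite mulrA divfK ?divff.
have uQ : u \in gaussian_rational.
  by apply: rpredM; [|apply: rpred_div]; apply: gaussianW.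
have ED : conjc z * reflection_defect u x = t.
  by rewrite -Et /reflection_defect /u; field.
have DQ : reflection_defect u x \in gaussian_rational.
  rewrite -[reflection_defect u x](mulKf cz0) ED mulrC.
  by apply: rpred_div => //; apply: gaussianW.
have tP : OC x (reflect_by u) <-> t \in gaussian.
  rewrite (OC_reflectP x u1 uQ) -ED; split=> [[g [h [gG hG ->]]]|DG].
    have -> : conjc z * (g + u * h) = conjc z * g + eps * z * h.
      by rewrite /u; field.
    by rewrite rpredD ?rpredM.
  (* From z k + conj(z) l = 1 comes
     D = conj(z) D l + u (conj(eps) conj(z) D k). *)
  have [k [l [kG lG E]]] := zmax.
  set D := reflection_defect u x in DG *.
  have cepsG : conjc eps \in gaussian by rewrite gaussian_conj.
  exists (conjc z * D * l), (conjc eps * (conjc z * D) * k).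
  split; [exact: rpredM|by apply: rpredM => //; apply: rpredM|].
  transitivity (D * (z * k + conjc z * l)); first by rewrite E mulr1.
  have -> : u * (conjc eps * (conjc z * D) * k) =
            eps * conjc eps * (z * D * k) by rewrite /u; field.
  by rewrite eps1; ring.
have [gen triv] := OC_reflect_dichotomy xQ u1 uQ DQ.
split=> [/tP/gen//|tG]; apply: triv => /tP.
exact/negP.
Qed.

Lemma int_ratio (k p q : int) : q != 0 -> coprimez p q ->
  ((k%:~R * (p%:~R / q%:~R) : R) \is a Num.int) = (q %| k)%Z.
Proof.
move=> q0 pq; have q0' : (q%:~R : R) != 0 by rewrite intr_eq0.
apply/intrP/idP=> [[n E]|/dvdzP[n ->]].
  have : (k * p)%:~R = (n * q)%:~R :> R.
    by rewrite !intrM -E mulrA divfK.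
  move=> /intr_inj E'; rewrite -(Gauss_dvdzl k (p := p)) ?E' ?dvdz_mull //.
  by rewrite coprimez_sym.
by exists (n * p); rewrite !intrM mulrA mulrAC mulfK.
Qed.

End Arithmetic.

(** * The cases of the theorem *)

Section Coordinates.
Variable R : realType.
Implicit Types (a b : R).

Lemma irrational_notin a b : irrational a \/ irrational b ->
  a +i* b \notin gaussian_rational.
Proof.
by move=> irr; apply/negP => /andP[/= /rationalP aQ /rationalP bQ]; case: irr.
Qed.

Lemma independent_rational a b (c d : R) :
  rationally_independent [tuple 1; a; b] ->
  c \in rational_pred -> d \in rational_pred ->
  c * a + d * b \in rational_pred -> c = 0 /\ d = 0.
Proof.
move=> indep /rationalP[p _ <-] /rationalP[q _ <-] /rationalP[r _ E].
pose v (i : 'I_3) : rat := nth 0 [:: - r; p; q] i.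
have v0 : forall i, v i = 0.
  apply: indep; rewrite !big_ord_recl big_ord0 /v /tnth /=.
  by rewrite rmorphN /= E; ring.
have := v0 (inord 1); have := v0 (inord 2).
by rewrite /v !inordK //= => -> ->; rewrite rmorph0.
Qed.

(** The real and imaginary parts of the defect are (1 - c) a - d b and
- d a + (1 + c) b for u = c + d i; independence forces both c = 1 and c = -1. *)
Lemma OC_independent a b : irrational a ->
  rationally_independent [tuple 1; a; b] -> OC (a +i* b) = [set id].
Proof.
move=> irr indep.
have xQ : a +i* b \notin gaussian_rational by apply: irrational_notin; left.
have [//|[[c d] [_ /andP[/= cQ dQ] /andP[/= re im] _]]] := OC_cases xQ.
have [c1 _] : 1 - c = 0 /\ - d = 0.
  apply: (independent_rational indep).
  - by rewrite rpredB ?rpred1.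
  - by rewrite rpredN.
  - have -> : (1 - c) * a + - d * b = a - (c * a - d * - b) by ring.
    exact: re.
have [_ c2] : - d = 0 /\ 1 + c = 0.
  apply: (independent_rational indep).
  - by rewrite rpredN.
  - by rewrite rpredD ?rpred1.
  - have -> : - d * a + (1 + c) * b = b - (c * - b + d * a) by ring.
    exact: im.
(* 2 is the sum of 1 - c and 1 + c. *)
have : (2 : R) = 0 by rewrite -[RHS](addr0 0) -{1}c1 -c2; ring.
by move/eqP; rewrite pnatr_eq0.
Qed.

Lemma gaussian_imaginary (t : R) : (0 +i* t \in gaussian) = (t \is a Num.int).
Proof. by rewrite gaussianE rpred0. Qed.

Lemma gaussian_real (t : R) : (t +i* 0 \in gaussian) = (t \is a Num.int).
Proof. by rewrite gaussianE rpred0 andbT. Qed.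

Lemma rational_nat_mul (n : nat) (t : R) :
  rational t -> n%:R * t \in rational_pred.
Proof. by move=> /rationalP tQ; rewrite rpredM ?rpred_nat. Qed.

Lemma reflection11 : reflection 1 1 = conjc :> (R[i] -> R[i]).
Proof.
by apply: funext => w; rewrite /reflection /rotation /comp conjc1 divr1 !mul1r.
Qed.

Lemma OC_rational_im a b : irrational a -> rational b ->
  (2 * b \is a Num.int -> OC (a +i* b) = generated conjc) /\
  (2 * b \isn't a Num.int -> OC (a +i* b) = [set id]).
Proof.
move=> irr bQ.
have xQ : a +i* b \notin gaussian_rational by apply: irrational_notin; left.
have := OC_reflection (z := 1) (eps := 1) (t := 0 +i* (2 * b))
  (rpred1 _) (conj_comaximal1 R) (rpred1 _) _ xQ.
rewrite reflection11 gaussian_imaginary; apply.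
- by rewrite conjc1 mulr1.
- by rewrite conjc1 !mul1r; apply/eqP; rewrite eq_complex /=;
    apply/andP; split; apply/eqP; ring.
- by rewrite gaussian_rationalE rpred0 rational_nat_mul.
Qed.

Lemma OC_rational_re a b : rational a -> irrational b ->
  (2 * a \is a Num.int -> OC (a +i* b) = generated (reflection 1 (-1))) /\
  (2 * a \isn't a Num.int -> OC (a +i* b) = [set id]).
Proof.
move=> aQ irr.
have xQ : a +i* b \notin gaussian_rational by apply: irrational_notin; right.
have := OC_reflection (z := 1) (eps := -1) (t := (2 * a) +i* 0)
  (rpred1 _) (conj_comaximal1 R) (rpredN1 _) _ xQ.
rewrite gaussian_real; apply.
- by rewrite rmorphN1 mulrNN mulr1.
- by rewrite conjc1 mulr1 mul1r; apply/eqP; rewrite eq_complex /=;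
    apply/andP; split; apply/eqP; ring.
- by rewrite gaussian_rationalE rpred0 rational_nat_mul.
Qed.

Section Line.
Variables (a b : R) (p1 q1 p2 q2 : int).
Hypotheses (irr : irrational a) (q1_neq0 : q1 != 0) (q2_neq0 : q2 != 0).
Hypotheses (cop1 : coprimez p1 q1) (cop2 : coprimez p2 q2).
Hypothesis line : a = p1%:~R / q1%:~R + p2%:~R / q2%:~R * b.

Let rho : R := p1%:~R / q1%:~R.

Let xQ : a +i* b \notin gaussian_rational.
Proof. by apply: irrational_notin; left. Qed.

Let line_int : q2%:~R * a = q2%:~R * rho + p2%:~R * b.
Proof.
have q2R : (q2%:~R : R) != 0 by rewrite intr_eq0.
by rewrite line -/rho mulrDr; congr (_ + _); field.
Qed.

Let rhoQ (k : int) : k%:~R * rho \in rational_pred.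
Proof. by rewrite rpredM ?rpred_div ?rpred_int. Qed.

Lemma OC_line_even : (2 %| p2 * q2)%Z ->
  let z : R[i] := p2%:~R +i* q2%:~R in
  admissible z /\
  ((q1 %| 2 * q2)%Z -> OC (a +i* b) = generated (reflection z 1)) /\
  (~~ (q1 %| 2 * q2)%Z -> OC (a +i* b) = [set id]).
Proof.
move=> ev z.
have zG : z \in gaussian by rewrite gaussianE !rpred_int.
have zmax : conj_comaximal z.
  by apply: conj_comaximal_coprime => //; apply: coprimez_sum_odd.
split; first exact: conj_comaximal_admissible.
(* Here conj(z) x - z conj(x) is -2 q2 rho i, whence the change of sign. *)
rewrite -(int_ratio R (2 * q2) q1_neq0 cop1) -/rho -[_ * rho]opprK rpredN.
rewrite -gaussian_imaginary.
apply: OC_reflection zG zmax (rpred1 _) _ xQ _ _.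
- by rewrite conjc1 mulr1.
- have -> : - ((2 * q2)%:~R * rho) = 2 * (p2%:~R * b - q2%:~R * a).
    by rewrite line_int intrM; ring.
  by apply/eqP; rewrite eq_complex /=; apply/andP; split; apply/eqP; ring.
- by rewrite gaussian_rationalE rpred0 rpredN rhoQ.
Qed.

(** The Gaussian integer z is (p2 + q2 i) / (1 + i), with coordinates
m = (p2 + q2) / 2 and n = (q2 - p2) / 2; their sum q2 is odd. *)
Lemma OC_line_odd : ~~ (2 %| p2 * q2)%Z ->
  let z : R[i] := ((p2 + q2)%:~R / 2) +i* (- ((p2 - q2)%:~R / 2)) in
  admissible z /\
  ((q1 %| q2)%Z -> OC (a +i* b) = generated (reflection z 'i)) /\
  (~~ (q1 %| q2)%Z -> OC (a +i* b) = [set id]).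
Proof.
move=> odd_pq z.
have [/odd_intP[s Ep] /odd_intP[r Eq]] := odd_int_mul odd_pq.
have [m [n [Ep2 Eq2]]] : exists m n, p2 = m - n /\ q2 = m + n.
  by exists (s + r + 1), (r - s); rewrite Ep Eq; split; ring.
have Ez : z = m%:~R +i* n%:~R.
  by rewrite /z Ep2 Eq2 !(intrD, rmorphN); apply/eqP;
    rewrite eq_complex /=; apply/andP; split; apply/eqP; field.
have zG : z \in gaussian by rewrite Ez gaussianE !rpred_int.
have zmax : conj_comaximal z.
  rewrite Ez; apply: conj_comaximal_coprime.
    have [[u v] /= B] := coprimezP _ _ cop2.
    by apply/coprimezP; exists (u + v, v - u); rewrite -B Ep2 Eq2 /=; ring.
  by rewrite -Eq2; apply/odd_intP; exists r.
split; first exact: conj_comaximal_admissible.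
rewrite -(int_ratio R q2 q1_neq0 cop1) -/rho.
(* Here conj(z) x - i z conj(x) is q2 rho (1 - i). *)
set y := q2%:~R * rho.
have -> : (y \is a Num.int) = (y -i* y \in gaussian).
  by rewrite gaussianE rpredN andbb.
apply: OC_reflection zG zmax (@gaussian_i R) _ xQ _ _.
- by apply/eqP; rewrite eq_complex /=; apply/andP; split; apply/eqP; ring.
- have -> : y = q2%:~R * a - p2%:~R * b by rewrite line_int addrK.
  rewrite Ez Ep2 Eq2 !(intrD, rmorphN); apply/eqP.
  by rewrite eq_complex /=; apply/andP; split; apply/eqP; ring.
- by rewrite gaussian_rationalE rpredN rhoQ.
Qed.

End Line.
End Coordinates.

Theorem theorem5p7 (R : realType) (a b : R) :
  let x : R[i] := a +i* b in
  (irrational a \/ irrational b ->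
     composition_group (OC x) /\ (OC x #<= `I_2)%card) /\
  (irrational a -> rational b ->
     (2 * b \is a Num.int -> OC x = generated conjc) /\
     (2 * b \isn't a Num.int -> OC x = [set id])) /\
  (rational a -> irrational b ->
     (2 * a \is a Num.int -> OC x = generated (reflection 1 (-1))) /\
     (2 * a \isn't a Num.int -> OC x = [set id])) /\
  (irrational a -> irrational b ->
     (rationally_independent [tuple 1; a; b] -> OC x = [set id]) /\
     (forall p1 q1 p2 q2 : int,
        q1 != 0 -> q2 != 0 -> coprimez p1 q1 -> coprimez p2 q2 ->
        a = p1%:~R / q1%:~R + p2%:~R / q2%:~R * b ->
        ((2 %| p2 * q2)%Z ->
           let z : R[i] := p2%:~R +i* q2%:~R in
           admissible z /\
           ((q1 %| 2 * q2)%Z -> OC x = generated (reflection z 1)) /\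
           (~~ (q1 %| 2 * q2)%Z -> OC x = [set id])) /\
        (~~ (2 %| p2 * q2)%Z ->
           let z : R[i] :=
             ((p2 + q2)%:~R / 2) +i* (- ((p2 - q2)%:~R / 2)) in
           admissible z /\
           ((q1 %| q2)%Z -> OC x = generated (reflection z 'i)) /\
           (~~ (q1 %| q2)%Z -> OC x = [set id])))).
Proof.
move=> x; split; first by move/irrational_notin; exact: OC_group_card.
split; first exact: OC_rational_im.
split; first exact: OC_rational_re.
move=> irr_a _; split; first exact: OC_independent.
move=> p1 q1 p2 q2 q1_neq0 q2_neq0 cop1 cop2 line; split.
  exact: (OC_line_even irr_a q1_neq0 q2_neq0 cop1 cop2 line).
exact: (OC_line_odd irr_a q1_neq0 q2_neq0 cop1 cop2 line).
Qed.
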